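(* For $k\in\mathbb{N}_0$ let \[ \alpha_q(k)=q^{2k}[8k+1]\frac{(q;q^4)_k^2\,(xq;q^4)_k\,(q/x;q^4)_k}{(q^4;q^4)_k^2\,(xq^4;q^4)_k\,(q^4/x;q^4)_k}, \] \[ s_q(k)=\sum_{j=0}^k\alpha_q(j)\alpha_q(k-j),\qquad t_q(k)=\sum_{j=0}^k\sum_{i=0}^{k-j}\alpha_q(j)\alpha_q(i)\alpha_q(k-j-i), \] \[ u_q(k)=\sum_{j=0}^k\sum_{i=0}^{k-j}\sum_{h=0}^{k-j-i}\alpha_q(j)\alpha_q(i)\alpha_q(h)\alpha_q(k-j-i-h). \] Then for every positive integer $n$ all of whose prime factors are congruent to $1$ modulo $4$, modulo $[n](1-xq^n)(x-q^n)$ we have \[ \sum_{k=0}^{n-1}s_q(k)\equiv[n]^2\frac{(q^2;q^4)_{(n-1)/4}^2}{(q^4;q^4)_{(n-1)/4}^2}q^{(1-n)/2},\qquad \sum_{k=0}^{n-1}t_q(k)\equiv[n]^3\frac{(q^2;q^4)_{(n-1)/4}^3}{(q^4;q^4)_{(n-1)/4}^3}q^{3(1-n)/4}, \] \[ \sum_{k=0}^{n-1}u_q(k)\equiv[n]^4\frac{(q^2;q^4)_{(n-1)/4}^4}{(q^4;q^4)_{(n-1)/4}^4}q^{1-n}. \]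
   Context: $x$ is an indeterminate and $q$ a variable. $(a;q)_0=1$, $(a;q)_k=\prod_{j=0}^{k-1}(1-aq^j)$; $[n]=[n]_q=(1-q^n)/(1-q)$. For rational functions $A,B$ and a polynomial $P$, $A\equiv B\pmod P$ means that, writing $A-B=A_1/A_2$ in lowest terms, $P$ divides $A_1$ and $\gcd(P,A_2)=1$. *)

(* Defs.v *)
From HB Require Import structures.
From mathcomp Require Import all_boot all_order all_algebra.

Set Implicit Arguments.
Unset Strict Implicit.
Unset Printing Implicit Defensive.
Import GRing.Theory.
Local Open Scope ring_scope.

(* Polynomials in x and q over the rationals; the outer variable is x.        *)
Notation Rqx := {poly {poly rat}}.
Notation Kqx := {fraction {poly {poly rat}}}.

Definition qvar : Kqx := FracField.tofrac ('X%:P : Rqx).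
Definition xvar : Kqx := FracField.tofrac ('X : Rqx).

(* The relation %| on {poly R} allows denominators from R, and is therefore   *)
(* not divisibility in Q[q][x].                                               *)
Definition divides (R : comUnitRingType) (d a : R) : Prop :=
  exists c : R, a = c * d.

Definition coprimer (R : comUnitRingType) (a b : R) : Prop :=
  forall d : R, divides d a -> divides d b -> d \is a GRing.unit.

(* The modulus M is given as an element of the fraction field because [n] is  *)
(* defined as a quotient; the relation requires M to be a polynomial P.       *)
Definition eqmodf (R : idomainType) (A B M : {fraction R}) : Prop :=
  exists P A1 A2 : R,
    [/\ M = FracField.tofrac P,
        A2 != 0 /\ A - B = FracField.tofrac A1 / FracField.tofrac A2,
        coprimer A1 A2,
        divides P A1 & coprimer P A2].

Section QSeries.
Variable K : fieldType.
Implicit Types a q x : K.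

Definition qpoch a q (k : nat) : K := \prod_(0 <= j < k) (1 - a * q ^+ j).

Definition qnum q (n : nat) : K := (1 - q ^+ n) / (1 - q).

Definition alpha q x (k : nat) : K :=
  q ^+ (2 * k)%N * qnum q (8 * k + 1)%N *
  ((qpoch q (q ^+ 4) k ^+ 2 * qpoch (x * q) (q ^+ 4) k
      * qpoch (q / x) (q ^+ 4) k) /
   (qpoch (q ^+ 4) (q ^+ 4) k ^+ 2 * qpoch (x * q ^+ 4) (q ^+ 4) k
      * qpoch (q ^+ 4 / x) (q ^+ 4) k)).

Definition s_ q x (k : nat) : K :=
  \sum_(0 <= j < k.+1) alpha q x j * alpha q x (k - j)%N.

Definition t_ q x (k : nat) : K :=
  \sum_(0 <= j < k.+1) \sum_(0 <= i < (k - j).+1)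
    alpha q x j * alpha q x i * alpha q x (k - j - i)%N.

Definition u_ q x (k : nat) : K :=
  \sum_(0 <= j < k.+1) \sum_(0 <= i < (k - j).+1)
    \sum_(0 <= h < (k - j - i).+1)
      alpha q x j * alpha q x i * alpha q x h * alpha q x (k - j - i - h)%N.

End QSeries.

(* Main.v *)
Require Import Defs.
From HB Require Import structures.
From mathcomp Require Import all_boot all_order all_algebra.
From mathcomp Require Import algC cyclotomic ring zify.
From Stdlib Require Import Classical.

Set Implicit Arguments.
Unset Strict Implicit.
Unset Printing Implicit Defensive.
Import GRing.Theory.
Local Open Scope ring_scope.

(* The modulus splits over the values x = q^n, x = q^-n and q = z, where z runs
   through the n-th roots of unity other than 1, so it suffices to compare both
   sides under these specializations.

   At x = q^n or q^-n the term alpha(k) vanishes for k > m = (n - 1)/4.  As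
   4m < n, the truncation of an l-fold convolution (l <= 4) loses nothing and
   the sum is the l-th power of sum_(k <= m) alpha(k), a terminating 6phi5 that
   has a closed form.

   At q = z of order d = 4r + 1 dividing n, alpha(ad + b) = gamma(a) alpha(b) for
   b < d, alpha(b) = 0 for r < b < d, and alpha(r - b) = - alpha(b), so that
   sum_(b <= r) alpha(b) = 0.  As 4r < d, the generating polynomial of an l-fold
   convolution has again the form C(X^d) W(X)^l with deg W^l < d, and the sum
   over a multiple of d terms is a multiple of W(1)^l = 0. *)

(** * q-Pochhammer symbols and the terminating sum of [alpha] *)

Section QPochhammer.
Variable K : fieldType.
Implicit Types a b q x : K.

Lemma qpoch0 a q : qpoch a q 0 = 1.
Proof. by rewrite /qpoch big_geq. Qed.

Lemma qpochS a q k : qpoch a q k.+1 = qpoch a q k * (1 - a * q ^+ k).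
Proof. by rewrite /qpoch big_nat_recr. Qed.

Lemma qpochD a q k l : qpoch a q (k + l) = qpoch a q k * qpoch (a * q ^+ k) q l.
Proof.
elim: l => [|l IHl]; first by rewrite addn0 qpoch0 mulr1.
by rewrite addnS !qpochS IHl exprD !mulrA.
Qed.

Lemma qpochSl a q k : qpoch a q k.+1 = (1 - a) * qpoch (a * q) q k.
Proof. by rewrite -add1n qpochD qpochS qpoch0 mul1r mulr1. Qed.

Lemma qpoch_neq0 a q k :
  (forall j, (j < k)%N -> a * q ^+ j != 1) -> qpoch a q k != 0.
Proof.
move=> H; rewrite /qpoch prodf_seq_neq0; apply/allP => j.
by rewrite mem_index_iota /= subr_eq0 eq_sym => /H.
Qed.

Lemma qpoch_eq0 a q k j : (j < k)%N -> a * q ^+ j = 1 -> qpoch a q k = 0.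
Proof.
move=> jk e; apply/eqP; rewrite /qpoch prodf_seq_eq0; apply/hasP.
by exists j; rewrite ?mem_index_iota // e subrr eqxx.
Qed.

(** Indexed by exponents, so that skipping j factors amounts to adding 4 j to [c] and [e]. *)
Definition qratio q c e k : K :=
  qpoch (q ^+ c) (q ^+ 4) k / qpoch (q ^+ e) (q ^+ 4) k.

Definition alpha_num q x k : K := qpoch q (q ^+ 4) k ^+ 2
  * qpoch (x * q) (q ^+ 4) k * qpoch (q / x) (q ^+ 4) k.

Definition alpha_den q x k : K := qpoch (q ^+ 4) (q ^+ 4) k ^+ 2
  * qpoch (x * q ^+ 4) (q ^+ 4) k * qpoch (q ^+ 4 / x) (q ^+ 4) k.

(** At a root of unity the first ratio may take the form 0/0, while the two that involve x keep
    nonzero denominators; each is specialized on its own. *)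
Lemma alpha_split q x k : alpha q x k =
  q ^+ (2 * k) * qnum q (8 * k + 1)
  * ((qpoch q (q ^+ 4) k / qpoch (q ^+ 4) (q ^+ 4) k) ^+ 2
    * (qpoch (x * q) (q ^+ 4) k / qpoch (x * q ^+ 4) (q ^+ 4) k)
    * (qpoch (q / x) (q ^+ 4) k / qpoch (q ^+ 4 / x) (q ^+ 4) k)).
Proof. by rewrite /alpha expr_div_n !mulf_div. Qed.

(** This symmetry reduces x = q^-n to x = q^n. *)
Lemma alpha_inv q x k : alpha q x^-1 k = alpha q x k.
Proof.
rewrite /alpha !invrK !(mulrC x^-1) -!(mulrC x).
by congr (_ * (_ / _)); rewrite mulrAC.
Qed.

(** The right-hand side for a convolution of [l.+1] factors; the congruences take [e = l.+1 * m]. *)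
Definition closed_form q n m l e : K := qnum q n ^+ l.+1
   * (qpoch (q ^+ 2) (q ^+ 4) m ^+ l.+1 / qpoch (q ^+ 4) (q ^+ 4) m ^+ l.+1)
   * q ^- e.

(** Induction step of [wz_sum] as an identity of rational functions, with A = q^(4m), B = q^(4k) and
    the common factor q^(2k) removed. The letters p, w, c, e, f, h replace the Pochhammer symbols of
    length k starting at q^5, q^4, q^6 A, 1/A, q^9 A, q^3/A, so that [field] applies. *)
Lemma wz_step (q A B p w c e f h : K) :
  q != 0 -> A != 0 -> 1 - q != 0 -> w != 0 -> f != 0 -> h != 0 ->
  1 - q ^+ 4 * B != 0 -> 1 - q ^+ 9 * A * B != 0 -> 1 - q ^+ 3 / A * B != 0 ->
  1 - q ^+ 5 * A != 0 -> 1 - (q * A)^-1 != 0 -> 1 - q ^+ 2 * A != 0 ->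
  let rho := (1 - q * A) * (1 - q ^+ 4 * A) * q
             / ((1 - q ^+ 5 * A) * (1 - q ^+ 2 * A)) in
  rho * (q ^+ 2 * ((1 - q ^+ 9 * B ^+ 2) / (1 - q)) *
    (((1 - q) * p) ^+ 2 * (c * (1 - q ^+ 6 * A * B))
       * ((1 - (q ^+ 4 * A)^-1) * e) /
     ((w * (1 - q ^+ 4 * B)) ^+ 2 * (f * (1 - q ^+ 9 * A * B))
       * ((1 - (q * A)^-1) * h))))
  - q ^+ 2 * ((1 - q ^+ 9 * B ^+ 2) / (1 - q)) *
    (((1 - q) * p) ^+ 2 * ((1 - q ^+ 2 * A) * c) * (e * (1 - A^-1 * B)) /
     ((w * (1 - q ^+ 4 * B)) ^+ 2 * ((1 - q ^+ 5 * A) * f)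
       * (h * (1 - q ^+ 3 / A * B))))
  = (rho - 1) *
    (q ^+ 2 * ((p * (1 - q ^+ 5 * B)) ^+ 2 * (c * (1 - q ^+ 6 * A * B))
         * (e * (1 - A^-1 * B)) /
       ((w * (1 - q ^+ 4 * B)) ^+ 2 * (f * (1 - q ^+ 9 * A * B))
         * (h * (1 - q ^+ 3 / A * B))))
     - p ^+ 2 * c * e / (w ^+ 2 * f * h)).
Proof.
move=> q0 A0 q1 w0 f0 h0 h1 h2 h3 h4 h5 h6 rho; rewrite /rho.
have h3' : A - q ^+ 3 * B != 0.
  apply: contraNneq h3 => e3.
  have -> : 1 - q ^+ 3 / A * B = (A - q ^+ 3 * B) / A by field.
  by rewrite e3 mul0r.
have h5' : q * A - 1 != 0.
  by apply: contraNneq h5 => /subr0_eq ->; rewrite invr1 subrr.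
field.
by rewrite q0 A0 q1 w0 f0 h0 h1 h2 h3' h4 h5' h6.
Qed.

(* Wilf-Zeilberger certificate for the sum at x = q A, A = q^(4m): if S(m) is the
   closed form and rho = S(m) / S(m+1), then rho times the summand for m + 1 minus
   the summand for m is the difference of a multiple of wz_cert (see wz_sum). *)
Definition wz_cert q A k : K :=
  q ^+ (2 * k) * (qpoch (q ^+ 5) (q ^+ 4) k ^+ 2
    * qpoch (q ^+ 6 * A) (q ^+ 4) k * qpoch A^-1 (q ^+ 4) k /
    (qpoch (q ^+ 4) (q ^+ 4) k ^+ 2
     * qpoch (q ^+ 9 * A) (q ^+ 4) k * qpoch (q ^+ 3 / A) (q ^+ 4) k)).

(** Splitting off the first factor of (q;q^4)_(k+1) leaves (q^5;q^4)_k, the symbol that occurs in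
    [wz_cert]. *)
Lemma alpha_recl q A k : q != 0 -> A != 0 ->
  alpha q (q * A) k.+1 =
  q ^+ (2 * k) * (q ^+ 2 * ((1 - q ^+ 9 * (q ^+ 4 ^+ k) ^+ 2) / (1 - q))
    * (((1 - q) * qpoch (q ^+ 5) (q ^+ 4) k) ^+ 2
       * qpoch (q ^+ 2 * A) (q ^+ 4) k.+1 * qpoch A^-1 (q ^+ 4) k.+1 /
     (qpoch (q ^+ 4) (q ^+ 4) k.+1 ^+ 2 * qpoch (q ^+ 5 * A) (q ^+ 4) k.+1
       * qpoch (q ^+ 3 / A) (q ^+ 4) k.+1))).
Proof.
move=> q0 A0; rewrite /alpha /qnum.
have -> : q * A * q = q ^+ 2 * A by ring.
have -> : q / (q * A) = A^-1 by field; rewrite A0.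
have -> : q * A * q ^+ 4 = q ^+ 5 * A by ring.
have -> : q ^+ 4 / (q * A) = q ^+ 3 / A by field; rewrite A0.
have -> : 1 - q ^+ (8 * k.+1 + 1) = 1 - q ^+ 9 * (q ^+ 4 ^+ k) ^+ 2.
  by rewrite -!exprM -exprD; congr (1 - q ^+ _); lia.
by rewrite [qpoch q _ _]qpochSl -exprS mulnS addnC exprD !mulrA.
Qed.

Section NotRootOfUnity.
Variable q : K.
Hypothesis q0 : q != 0.
Hypothesis q_gt0 : forall i, (0 < i)%N -> q ^+ i != 1.

Lemma expr_not_root_inj i j : q ^+ i = q ^+ j -> i = j.
Proof.
wlog ij : i j / (i <= j)%N => [hw e|].
  by case/orP: (leq_total i j) => ij; [|apply/esym]; apply: hw.
rewrite -{1}(subnK ij) exprD => /eqP.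
rewrite -{1}[q ^+ i]mul1r (inj_eq (mulIf (expf_neq0 i q0))) eq_sym.
by have [|/q_gt0/negPf->] := posnP (j - i); [lia|].
Qed.

Lemma wz_sum m k : let A := q ^+ 4 ^+ m in
  let rho := (1 - q * A) * (1 - q ^+ 4 * A) * q
             / ((1 - q ^+ 5 * A) * (1 - q ^+ 2 * A)) in
  \sum_(0 <= j < k.+1)
    (rho * alpha q (q * (q ^+ 4 * A)) j - alpha q (q * A) j)
  = (rho - 1) * wz_cert q A k.
Proof.
move=> A rho; have A0 : A != 0 by rewrite !expf_neq0.
have sub i : (0 < i)%N -> 1 - q ^+ i != 0.
  by move=> i0; rewrite subr_eq0 eq_sym q_gt0.
have AE i : q ^+ i * A = q ^+ (i + 4 * m) by rewrite /A -exprM -exprD.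
have subQ i j : (0 < i)%N -> 1 - q ^+ i * A * q ^+ 4 ^+ j != 0.
  by move=> i0; rewrite AE -exprM -exprD sub // !addn_gt0 i0.
have q4 i : 1 - q ^+ 4 * q ^+ 4 ^+ i != 0 by rewrite -exprM -exprD sub.
(* A zero factor would give q^(3+4i) = q^(4m), but the exponents differ modulo 4. *)
have q3 i : 1 - q ^+ 3 / A * q ^+ 4 ^+ i != 0.
  apply/negP; rewrite subr_eq0 mulrAC -(inj_eq (mulIf A0)) mulfVK // mul1r.
  rewrite /A -!exprM -exprD => /eqP e.
  have := expr_not_root_inj e; lia.
have q1 : 1 - q != 0 by rewrite -[q]expr1 sub.
have q1A : 1 - (q * A)^-1 != 0.
  rewrite -[q in q * A]expr1 AE -(inj_eq (mulIf (expf_neq0 (1 + 4 * m) q0))).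
  by rewrite mul0r mulrBl mulVf ?expf_neq0 // mul1r -oppr_eq0 opprB sub.
elim: k => [|k IHk].
  rewrite big_nat1 /alpha /wz_cert /qnum !qpoch0 !muln0 add0n !expr0 !expr1.
  by rewrite expr1n !(mulr1, mul1r) divr1 divff // !divr1 !mulr1.
rewrite big_nat_recr //= {}IHk /wz_cert !alpha_recl ?mulf_neq0 ?expf_neq0 //.
have -> : q ^+ 2 * (q ^+ 4 * A) = q ^+ 6 * A by ring.
have -> : q ^+ 5 * (q ^+ 4 * A) = q ^+ 9 * A by ring.
have -> : q ^+ 3 / (q ^+ 4 * A) = (q * A)^-1 by field; rewrite q0 A0.
rewrite (qpochSl (q ^+ 2 * A)) (qpochSl (q ^+ 4 * A)^-1).
rewrite (qpochSl (q ^+ 5 * A)) (qpochSl (q * A)^-1).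
have -> : q ^+ 2 * A * q ^+ 4 = q ^+ 6 * A by ring.
have -> : (q ^+ 4 * A)^-1 * q ^+ 4 = A^-1 by field; rewrite q0 A0.
have -> : q ^+ 5 * A * q ^+ 4 = q ^+ 9 * A by ring.
have -> : (q * A)^-1 * q ^+ 4 = q ^+ 3 / A by field; rewrite q0 A0.
rewrite !qpochS mulnS addnC exprD -/rho.
have qp i (i0 : (0 < i)%N) : qpoch (q ^+ i) (q ^+ 4) k != 0.
  apply: qpoch_neq0 => j _; rewrite -exprM -exprD q_gt0 //.
  by rewrite addn_gt0 i0.
have w0 := qp 4 isT.
have f0 : qpoch (q ^+ 9 * A) (q ^+ 4) k != 0.
  by apply: qpoch_neq0 => j _; rewrite -subr_eq0 -oppr_eq0 opprB subQ.
have h0 : qpoch (q ^+ 3 / A) (q ^+ 4) k != 0.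
  by apply: qpoch_neq0 => j _; rewrite -subr_eq0 -oppr_eq0 opprB q3.
have s5 : 1 - q ^+ 5 * A != 0 by rewrite AE sub.
have s2 : 1 - q ^+ 2 * A != 0 by rewrite AE sub.
have := wz_step (qpoch (q ^+ 5) (q ^+ 4) k) (qpoch (q ^+ 6 * A) (q ^+ 4) k)
  (qpoch A^-1 (q ^+ 4) k) q0 A0 q1 w0 f0 h0 (q4 k) (subQ 9 k isT) (q3 k)
  s5 q1A s2.
rewrite -/rho => wz.
rewrite [rho * _]mulrCA -mulrBr wz; ring.
Qed.

(** Induction on [m]: [wz_sum] is taken up to [k = m.+1], where the certificate vanishes, so the sum
    for [m] is [rho] times the sum for [m.+1]. *)
Lemma sum_alpha_terminating m :
  \sum_(0 <= k < m.+1) alpha q (q ^+ (4 * m + 1)) k =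
  qnum q (4 * m + 1)
  * (qpoch (q ^+ 2) (q ^+ 4) m / qpoch (q ^+ 4) (q ^+ 4) m) * q ^- m.
Proof.
have sub i : (0 < i)%N -> 1 - q ^+ i != 0.
  by move=> i0; rewrite subr_eq0 eq_sym q_gt0.
have q1 : 1 - q != 0 by rewrite -[q]expr1 sub.
elim: m => [|m IHm].
  by rewrite big_nat1 /alpha /qnum !qpoch0 !muln0 !add0n !expr0 !expr1
    expr1n !(mulr1, mul1r) divff // !(divr1, invr1, mulr1).
have := wz_sum m m.+1; rewrite /= /wz_cert.
set A := q ^+ 4 ^+ m; set rho := _ / _.
have A0 : A != 0 by rewrite !expf_neq0.
have AE i : q ^+ i * A = q ^+ (i + 4 * m) by rewrite /A -exprM -exprD.
rewrite (@qpoch_eq0 A^-1 _ _ m) ?mulVf // !(mulr0, mul0r).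
rewrite sumrB -mulr_sumr => /eqP; rewrite subr_eq0 => /eqP.
rewrite [RHS]big_nat_recr //=.
(* The common range has one term more than the sum for [m]; it vanishes by the same factor 1 - A^-1
   q^(4m). *)
have -> : alpha q (q * A) m.+1 = 0.
  by rewrite alpha_recl // (@qpoch_eq0 A^-1 _ m.+1 m) ?mulVf // !(mulr0, mul0r).
have -> : q * A = q ^+ (4 * m + 1) by rewrite -{1}[q]expr1 AE addnC.
have -> : q * (q ^+ 4 * A) = q ^+ (4 * m.+1 + 1).
  by rewrite mulrA -exprS AE; congr (_ ^+ _); lia.
have rho0 : rho != 0.
  by rewrite /rho -{1}[q]expr1 !AE !(mulf_neq0, invr_eq0) ?sub.
rewrite addr0 IHm => e; apply: (mulfI rho0); rewrite e /rho /qnum !qpochS.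
have -> : 1 - q ^+ (4 * m + 1) = 1 - q * A by rewrite -{2}[q]expr1 AE addnC.
have -> : 1 - q ^+ (4 * m.+1 + 1) = 1 - q ^+ 5 * A.
  by rewrite AE; congr (1 - q ^+ _); lia.
have w0 : qpoch (q ^+ 4) (q ^+ 4) m != 0.
  by apply: qpoch_neq0 => j _; rewrite -exprM -exprD q_gt0.
rewrite -/A (exprS q m); move: w0.
move: (qpoch _ _ m) (qpoch _ _ m) => p w w0; field.
by rewrite q0 w0 q1 expf_neq0 // !AE !sub.
Qed.
End NotRootOfUnity.
End QPochhammer.

(** * Reflection of [alpha] when z^(4r+1) = 1 *)

Section Reflection.
Variables (K : fieldType) (z x : K) (r : nat).
Hypotheses (z_root : z ^+ (4 * r + 1) = 1) (x0 : x != 0).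

Local Notation num := (alpha_num z x).
Local Notation den := (alpha_den z x).

(* Both sides pair the factors with u = z^(4k+1) and v = z^(4(r-k)), where
   u * v = 1. *)
Lemma alpha_num_reflect k : (k <= r)%N ->
  num k * den (r - k) = z ^+ (8 * (k * k) - 4 * k) * den r.
Proof.
elim: k => [|k IHk] kr.
  by rewrite subn0 /alpha_num !qpoch0 !muln0 expr1n !mul1r.
have := IHk (ltnW kr).
(* The truncated subtractions are exact, since 4 k <= 8 k^2. *)
have -> : (8 * (k.+1 * k.+1) - 4 * k.+1 = 4 * (4 * k + 1) + (8 * (k * k) - 4 * k))%N.
  nia.
rewrite exprD -mulrA => <-; rewrite -(subnSK kr) /alpha_num /alpha_den !qpochS.
set u := z ^+ (4 * k + 1); set v := z ^+ 4 * z ^+ 4 ^+ (r - k.+1).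
have uv : u * v = 1.
  rewrite /u /v -exprM -!exprD -[RHS]z_root; congr (_ ^+ _); lia.
have uE a : z * a * z ^+ 4 ^+ k = a * u.
  by rewrite /u mulrAC [RHS]mulrC -exprM -exprS addn1.
have vE a : z ^+ 4 * a * z ^+ 4 ^+ (r - k.+1) = a * v.
  by rewrite /v mulrAC mulrC.
rewrite -[X in 1 - X * z ^+ 4 ^+ k]mulr1 (mulrC x z) (mulrC x (z ^+ 4)) !uE !vE -/v.
(* As v = 1/u, 1 - a u = - a u (1 - v/a). Over a = 1, 1, x, 1/x the signs and the a cancel, and u^4
   remains. *)
have -> : z ^+ (4 * (4 * k + 1)) = u ^+ 4 by rewrite /u -exprM mulnC.
have u0 : u != 0.
  by apply/eqP => u0; move/eqP: uv; rewrite u0 mul0r eq_sym oner_eq0.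
have -> : v = u^-1 by rewrite -[LHS]mul1r -(mulVf u0) -mulrA uv mulr1.
by field; rewrite x0 u0.
Qed.

Hypothesis den_neq0 : forall k, (k <= r)%N -> den k != 0.

(** The quotient of denominators in [alphaE] is symmetric in j and r - j. The sign comes from the
    q-integers, whose indices 8k+1 and 8(r-k)+1 add up to 2(4r+1). *)
Lemma alpha_reflect k : (k <= r)%N -> alpha z x (r - k) = - alpha z x k.
Proof.
move=> kr; have alphaE j : (j <= r)%N -> alpha z x j =
    z ^+ (2 * j + (8 * (j * j) - 4 * j)) * qnum z (8 * j + 1)
    * (den r / (den j * den (r - j))).
  move=> jr; have d1 := den_neq0 jr; have d2 := den_neq0 (leq_subr j r).
  rewrite /alpha -/(alpha_num z x j) -/(alpha_den z x j) exprD.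
  have -> : num j = z ^+ (8 * (j * j) - 4 * j) * den r / den (r - j).
    by rewrite -alpha_num_reflect // mulfK.
  by field; rewrite d1 d2.
rewrite !alphaE ?leq_subr // subKn // [den (r - k) * _]mulrC -mulNr.
congr (_ * _); rewrite /qnum !mulrA -mulNr; congr (_ / _).
set j := (r - k)%N; have rE : r = (k + j)%N by lia.
have e : z ^+ (2 * j + (8 * (j * j) - 4 * j)) =
    z ^+ (8 * k + 1) * z ^+ (2 * k + (8 * (k * k) - 4 * k)).
  (* The exponents agree only modulo 4r+1; adding [2 * k + 1] and [2 * j] periods makes them
     equal. *)
  rewrite -exprD -[LHS]mulr1 -(expr1n _ (2 * k + 1)) -z_root -exprM -exprD.
  rewrite -[RHS]mulr1 -(expr1n _ (2 * j)) -z_root -!exprM -!exprD.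
  by congr (_ ^+ _); move: rE; clear; nia.
have e1 : z ^+ (8 * k + 1) * z ^+ (8 * j + 1) = 1.
  rewrite -exprD -(expr1n _ 2) -z_root -exprM; congr (_ ^+ _); lia.
rewrite {}e; move: (z ^+ (8 * k + 1)) (z ^+ (8 * j + 1)) e1 => u t ut.
by rewrite mulrAC mulrBr mulr1 ut; ring.
Qed.

Lemma sum_alpha_root : (2 : K) != 0 -> \sum_(0 <= k < r.+1) alpha z x k = 0.
Proof.
move=> two; set S := \sum_(_ <= _ < _) _; apply: (mulfI two).
suff /eqP : S = - S by rewrite -subr_eq0 opprK mulr0 mulr_natl mulr2n => /eqP.
rewrite {1}/S big_nat_rev /= -sumrN; apply: eq_big_nat => k /andP[_ kr].
by rewrite add0n subSS alpha_reflect.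
Qed.

Lemma alpha_eq0 k : (r < k)%N -> alpha z x k = 0.
Proof.
move=> rk; rewrite /alpha (@qpoch_eq0 _ z _ k r) //.
  by rewrite expr0n /= !mul0r mulr0.
by rewrite -exprM -exprS -addn1.
Qed.

End Reflection.

(** * Convolutions as coefficients of polynomial powers *)

Section Convolution.
Variable K : fieldType.
Implicit Types (v : nat -> K) (p C W : {poly K}).

(* convpow l is the convolution of l + 1 factors. *)
Fixpoint convpow l v : nat -> K :=
  if l is l'.+1 then
    fun k => \sum_(0 <= j < k.+1) v j * convpow l' v (k - j)%N
  else v.

Lemma t_convpow q x k : t_ q x k = convpow 2 (alpha q x) k.
Proof.
apply: eq_bigr => j _; rewrite /= mulr_sumr.
by apply: eq_bigr => i _; rewrite mulrA.
Qed.

Lemma u_convpow q x k : u_ q x k = convpow 3 (alpha q x) k.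
Proof.
apply: eq_bigr => j _; rewrite /= mulr_sumr; apply: eq_bigr => i _.
by rewrite !mulr_sumr; apply: eq_bigr => h _; rewrite !mulrA.
Qed.

(** A convolution at [k] involves only indices up to [k], so agreement below [n] is enough. *)
Lemma convpow_coef n v p : (forall k, (k < n)%N -> v k = p`_k) ->
  forall l k, (k < n)%N -> convpow l v k = (p ^+ l.+1)`_k.
Proof.
move=> vp; elim=> [|l IHl] k kn /=; first by rewrite expr1 vp.
rewrite exprS coefM big_mkord; apply: eq_bigr => j _.
have jk : (j <= k)%N by rewrite -ltnS.
by rewrite vp ?IHl //; apply: leq_ltn_trans kn; rewrite ?leq_subr.
Qed.

(** Since deg W < d, the shifted copies of W occupy disjoint blocks of d indices. *)
Lemma coef_comp_polyXnM d C W k : (0 < d)%N -> (size W <= d)%N ->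
  ((C \Po 'X^d) * W)`_k = C`_(k %/ d) * W`_(k %% d).
Proof.
move=> d0 sW; rewrite comp_polyE mulr_suml coef_sum.
have E (i : nat) : (C`_i *: 'X^d ^+ i * W)`_k =
    if i == (k %/ d)%N then C`_(k %/ d) * W`_(k %% d) else 0.
  rewrite -exprM -scalerAl coefZ coefXnM; case: eqP => [->|ne].
    rewrite mulnC ltnNge leq_trunc_div /=; congr (_ * W`__).
    by rewrite {1}(divn_eq k d) addKn.
  case: ltnP => dk; first by rewrite mulr0.
  rewrite [W`__]nth_default ?mulr0 // (leq_trans sW) // leqNgt; apply/negP => lt.
  case: ne; apply/eqP; rewrite eqn_leq leq_divRL // mulnC dk /=.
  by rewrite -ltnS ltn_divLR // mulSn mulnC; lia.
under eq_bigr => i _ do rewrite E.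
rewrite -big_mkcond /=; have [kC|Ck] := ltnP (k %/ d) (size C).
  by rewrite (big_pred1 (Ordinal kC)).
rewrite big_pred0 => [|i]; first by rewrite [C`__]nth_default ?mul0r.
by apply/negbTE; rewrite neq_ltn (leq_trans (ltn_ord i)).
Qed.

Lemma sum_divmod d N (f g : nat -> K) : (0 < d)%N ->
  \sum_(0 <= k < N * d) f (k %/ d)%N * g (k %% d)%N =
  (\sum_(0 <= a < N) f a) * \sum_(0 <= b < d) g b.
Proof.
move=> d0; elim: N => [|N IHN].
  by rewrite mul0n [LHS]big_geq // [X in X * _]big_geq // mul0r.
rewrite mulSnr (big_cat_nat (n := N * d)) ?leq_addr //= IHN.
rewrite big_nat_recr //= mulrDl; congr (_ + _).
rewrite -{1}[(N * d)%N]add0n big_addn addKn mulr_sumr.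
apply: eq_big_nat => b /andP[_ bd].
by rewrite addnC divnMDl // modnMDl divn_small // modn_small // addn0.
Qed.

(** The bound on [W ^+ l.+1] keeps the blocks disjoint after taking powers, and each block sums to a
    multiple of W(1)^(l+1). The case [N = 1], [C = 1] serves x = q^n and x = q^-n. *)
Lemma sum_convpow d N C W v l : (0 < d)%N ->
    (size (W ^+ l.+1) <= d)%N -> (size W <= d)%N ->
    (forall k, (k < N * d)%N -> v k = C`_(k %/ d) * W`_(k %% d)) ->
  \sum_(0 <= k < N * d) convpow l v k =
  (\sum_(0 <= a < N) (C ^+ l.+1)`_a) * W.[1] ^+ l.+1.
Proof.
move=> d0 sWl sW vE.
have vp k : (k < N * d)%N -> v k = ((C \Po 'X^d) * W)`_k.
  by move=> kn; rewrite vE // coef_comp_polyXnM.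
rewrite (eq_big_nat _ _ (F2 := fun k => (C ^+ l.+1)`_(k %/ d) *
   (W ^+ l.+1)`_(k %% d))) => [|k /andP[_ kn]].
  rewrite sum_divmod //; congr (_ * _).
  rewrite -horner_exp (horner_coef_wide _ sWl) big_mkord.
  by apply: eq_bigr => i _; rewrite expr1n mulr1.
by rewrite (convpow_coef vp) // exprMn -(rmorphXn (comp_poly _)) /= coef_comp_polyXnM.
Qed.
End Convolution.

(** * Values of fractions under a ring morphism *)

Section Specialization.
Variables (R : idomainType) (L : fieldType) (phi : {rmorphism R -> L}).
Local Notation tofrac := (@FracField.tofrac R).
Implicit Types (f g : {fraction R}) (v w : L).

(* f is regular at the kernel of phi and takes the value v there. *)
Definition specializes f v := exists a b : R,
  [/\ f = tofrac a / tofrac b, phi b != 0 & v = phi a / phi b].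

Lemma tofrac_neq0 b : phi b != 0 -> tofrac b != 0.
Proof. by apply: contraNneq => /eqP; rewrite tofrac_eq0 => /eqP->; rewrite rmorph0. Qed.

Lemma spec_tofrac a : specializes (tofrac a) (phi a).
Proof. by exists a, 1; rewrite !rmorph1 !divr1 oner_eq0. Qed.

Lemma spec_1 : specializes 1 1.
Proof. by have := spec_tofrac 1; rewrite !rmorph1. Qed.

Lemma spec_0 : specializes 0 0.
Proof. by have := spec_tofrac 0; rewrite !rmorph0. Qed.

Lemma spec_add f g v w :
  specializes f v -> specializes g w -> specializes (f + g) (v + w).
Proof.
move=> [a [b [-> b0 ->]]] [c [d [-> d0 ->]]].
exists (a * d + c * b), (b * d); have B0 := tofrac_neq0 b0.
have D0 := tofrac_neq0 d0.
by rewrite !rmorphD !rmorphM /= mulf_neq0 // -!addf_div.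
Qed.

Lemma spec_mul f g v w :
  specializes f v -> specializes g w -> specializes (f * g) (v * w).
Proof.
move=> [a [b [-> b0 ->]]] [c [d [-> d0 ->]]]; exists (a * c), (b * d).
by rewrite !rmorphM /= mulf_neq0 // !mulf_div.
Qed.

Lemma spec_opp f v : specializes f v -> specializes (- f) (- v).
Proof.
move=> [a [b [-> b0 ->]]]; exists (- a), b; by rewrite !rmorphN !mulNr.
Qed.

Lemma spec_sub f g v w :
  specializes f v -> specializes g w -> specializes (f - g) (v - w).
Proof. by move=> fv gw; apply: spec_add => //; apply: spec_opp. Qed.

Lemma spec_inv f v : v != 0 -> specializes f v -> specializes f^-1 v^-1.
Proof.
move=> v0 [a [b [-> b0 e]]]; exists b, a.
by rewrite e !invf_div; split=> //; apply: contraNneq v0 => a0;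
  rewrite e a0 mul0r.
Qed.

Lemma spec_div f g v w : w != 0 ->
  specializes f v -> specializes g w -> specializes (f / g) (v / w).
Proof. by move=> w0 fv gw; apply: spec_mul => //; apply: spec_inv. Qed.

Lemma spec_prod I (s : seq I) (P : pred I) (F : I -> {fraction R}) G :
  (forall i, P i -> specializes (F i) (G i)) ->
  specializes (\prod_(i <- s | P i) F i) (\prod_(i <- s | P i) G i).
Proof.
move=> FG; apply: (big_ind2 specializes) => // [|*]; first exact: spec_1.
exact: spec_mul.
Qed.

Lemma spec_sum_nat m n (F : nat -> {fraction R}) G :
  (forall i, (m <= i < n)%N -> specializes (F i) (G i)) ->
  specializes (\sum_(m <= i < n) F i) (\sum_(m <= i < n) G i).
Proof.
move=> FG; rewrite big_nat [X in specializes _ X]big_nat.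
by apply: (big_ind2 specializes) => //; [exact: spec_0|move=> *; exact: spec_add].
Qed.

Lemma spec_exp f v n : specializes f v -> specializes (f ^+ n) (v ^+ n).
Proof.
move=> fv; elim: n => [|n IHn]; first exact: spec_1.
by rewrite !exprS; apply: spec_mul.
Qed.

(** Cross-multiplying with a representation c/d that is regular under [phi] gives phi(a) phi(d) = 0;
    this covers representations with phi(b) = 0. *)
Lemma spec_eq0 f a b : specializes f 0 -> f = tofrac a / tofrac b -> b != 0 ->
  phi a = 0.
Proof.
move=> [c [d [-> d0 e]]] e' b0; have D0 := tofrac_neq0 d0.
have B0 : tofrac b != 0 by rewrite tofrac_eq0.
move/eqP: e'; rewrite eqr_div // -!rmorphM /= -subr_eq0 -rmorphB tofrac_eq0.
rewrite subr_eq0 => /eqP/(congr1 phi); rewrite !rmorphM.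
have -> : phi c = 0.
  by apply/eqP; move/esym/eqP: e; rewrite mulf_eq0 invr_eq0 (negPf d0) orbF.
by rewrite mul0r => /esym/eqP; rewrite mulf_eq0 (negPf d0) orbF => /eqP.
Qed.

Lemma spec_qpoch f g v w k : specializes f v -> specializes g w ->
  specializes (qpoch f g k) (qpoch v w k).
Proof.
move=> fv gw; apply: spec_prod => i _.
by apply: spec_sub; [exact: spec_1|apply: spec_mul => //; apply: spec_exp].
Qed.

Lemma spec_convpow n F G l : (forall k, (k < n)%N -> specializes (F k) (G k)) ->
  forall k, (k < n)%N -> specializes (convpow l F k) (convpow l G k).
Proof.
move=> FG; elim: l => [|l IHl] k kn /=; first exact: FG.
apply: spec_sum_nat => j; rewrite ltnS => /= jk.
by apply: spec_mul; [apply: FG|apply: IHl]; apply: leq_ltn_trans kn; rewrite ?leq_subr.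
Qed.

Section QSpecialization.
Variables (q : {fraction R}) (z : L).
Hypotheses (qz : specializes q z) (z1 : 1 - z != 0).

Lemma spec_qnum n : specializes (qnum q n) (qnum z n).
Proof.
apply: spec_div => //; apply: spec_sub; (try exact: spec_1) => //; exact: spec_exp.
Qed.

Lemma spec_qpoch_ratio f v k : specializes f v ->
  forall g w, specializes g w -> qpoch w (z ^+ 4) k != 0 ->
  specializes (qpoch f (q ^+ 4) k / qpoch g (q ^+ 4) k)
    (qpoch v (z ^+ 4) k / qpoch w (z ^+ 4) k).
Proof.
by move=> fv g w gw w0; apply: spec_div => //; apply: spec_qpoch => //; apply: spec_exp.
Qed.

(** * Specializing q to a primitive root of unity of order d = 4r+1 *)

Section RootOfUnity.
Variable r : nat.
Let d := (4 * r + 1)%N.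
Hypothesis q_gt0 : forall i, (0 < i)%N -> q ^+ i != 1.
Hypothesis z_prim : d.-primitive_root z.
Hypothesis L_char0 : forall i, (i.+1%:R : L) != 0.

Let zd : z ^+ d = 1 := prim_expr_order z_prim.

(** Both differences vanish at z. Cancelling 1 - q^d leaves geometric sums with values s and t. *)
Lemma spec_sub_ratio s t : (0 < t)%N ->
  specializes ((1 - q ^+ (d * s)) / (1 - q ^+ (d * t))) (s%:R / t%:R).
Proof.
move=> t0; have d0 : (0 < d)%N by rewrite /d addn1.
have E i : 1 - q ^+ (d * i) = (1 - q ^+ d) * \sum_(0 <= j < i) (q ^+ d) ^+ j.
  by rewrite exprM -opprB subrX1 -mulNr opprB big_mkord.
have S i : specializes (\sum_(0 <= j < i) (q ^+ d) ^+ j) i%:R.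
  have -> : i%:R = \sum_(0 <= j < i) (z ^+ d) ^+ j.
    under eq_bigr => j _ do rewrite zd expr1n.
    by rewrite sumr_const_nat subn0.
  by apply: spec_sum_nat => j _; do 2 apply: spec_exp.
rewrite !E -mulf_div divff ?mul1r; last by rewrite subr_eq0 eq_sym q_gt0.
by apply: spec_div => //; rewrite -(prednK t0) L_char0.
Qed.

Lemma prim_expr_neq1 i : ~~ (d %| i)%N -> z ^+ i != 1.
Proof. by apply: contraNneq => /eqP; rewrite -(prim_order_dvd z_prim). Qed.

Lemma dvd_4mul i : (d %| 4 * i)%N = (d %| i)%N.
Proof.
apply: Gauss_dvdr.
by rewrite coprime_sym /coprime -gcdn_modr /d mulnC modnMDl.
Qed.

(* Each block of d factors contains exactly one that vanishes at z, both in the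
   numerator and in the denominator; these two cancel by spec_sub_ratio. *)
Lemma spec_qratio_block c a :
  {v | specializes (qratio q (c + 4 * (a * d)) (4 + 4 * (a * d)) d) v}.
Proof.
have d0 : (0 < d)%N by rewrite /d addn1.
(* The positions of the vanishing factors: 4r = -1 modulo d, so j = r c solves c + 4j = 0, and j = d
   - 1 solves 4 + 4j = 0. *)
pose j0 := Ordinal (ltn_pmod (r * c) d0).
pose j1 := Ordinal (ltn_pmod d.-1 d0).
rewrite /qratio /qpoch !big_mkord (bigD1 j0) //= [in X in _ / X](bigD1 j1) //=.
have e0 : (d %| c + 4 * j0)%N.
  rewrite /dvdn -modnDmr modnMmr modnDmr mulnA.
  have -> : (c + 4 * r * c = c * d)%N by rewrite /d; lia.
  by rewrite modnMl.
have [s sE] : {s | c + 4 * (a * d) + 4 * j0 = d * s}%N.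
  exists ((c + 4 * j0) %/ d + 4 * a)%N.
  by rewrite mulnDr [(d * (_ %/ _))%N]mulnC divnK // (mulnC d) -mulnA; lia.
have tE : (4 + 4 * (a * d) + 4 * j1 = d * (4 * a.+1))%N.
  rewrite /= modn_small ?ltn_predL //.
  have gen e : (0 < e -> 4 + 4 * (a * e) + 4 * e.-1 = e * (4 * a.+1))%N.
    by case: e => // e _ /=; nia.
  exact: gen.
exists ((s%:R / (4 * a.+1)%:R) *
  ((\prod_(i < d | i != j0) (1 - z ^+ (c + 4 * (a * d)) * z ^+ 4 ^+ i)) /
   (\prod_(i < d | i != j1) (1 - z ^+ (4 + 4 * (a * d)) * z ^+ 4 ^+ i)))).
rewrite -mulf_div -!exprM -!exprD sE tE.
apply: spec_mul; first exact: spec_sub_ratio.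
have spf e (j : 'I_d) :
    specializes (1 - q ^+ e * q ^+ 4 ^+ j) (1 - z ^+ e * z ^+ 4 ^+ j).
  apply: spec_sub; first exact: spec_1.
  by apply: spec_mul; do !apply: spec_exp.
apply: spec_div; last 2 first.
- by apply: spec_prod => j _; apply: spf.
- by apply: spec_prod => j _; apply: spf.
apply/prodf_neq0 => j jj1; rewrite subr_eq0 eq_sym -exprM -exprD.
apply: prim_expr_neq1.
have -> : (4 + 4 * (a * d) + 4 * j = 4 * (a * d + j.+1))%N by lia.
rewrite dvd_4mul dvdn_addr ?dvdn_mull //; apply: contra jj1 => /dvdn_leq.
move=> /(_ isT) dj; apply/eqP/val_inj => /=.
rewrite modn_small ?ltn_predL //; have := ltn_ord j; lia.
Qed.

Lemma spec_qratio_mul c a : {v | specializes (qratio q c 4 (a * d)) v}.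
Proof.
elim: a => [|a [v IHa]].
  by exists 1; rewrite /qratio !qpoch0 divr1; apply: spec_1.
have [w wP] := spec_qratio_block c a; exists (v * w).
have -> : qratio q c 4 (a.+1 * d) =
    qratio q c 4 (a * d) * qratio q (c + 4 * (a * d)) (4 + 4 * (a * d)) d.
  by rewrite /qratio mulSnr !qpochD -!exprM -!exprD mulf_div.
exact: spec_mul.
Qed.

Lemma expr_mul_order c a : c * z ^+ 4 ^+ (a * d) = c.
Proof. by rewrite -exprM mulnA mulnC exprM zd expr1n mulr1. Qed.

Lemma qpoch4_neq0 b : (b < d)%N -> qpoch (z ^+ 4) (z ^+ 4) b != 0.
Proof.
move=> bd; apply: qpoch_neq0 => j jb; rewrite -exprS -exprM prim_expr_neq1 //.
by rewrite dvd_4mul; apply/negP => /(dvdn_leq (ltn0Sn j)); lia.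
Qed.

(** The first a d factors contribute [beta a]; the other b factors are shifted by 4 a d in the
    exponent, which z does not see. The sig type yields [beta] as a function without choice. *)
Lemma spec_qratio c : {beta : nat -> L | forall a b, (b < d)%N ->
  specializes (qratio q c 4 (a * d + b)) (beta a * qratio z c 4 b)}.
Proof.
exists (fun a => sval (spec_qratio_mul c a)) => a b bd.
case: spec_qratio_mul => v /= vP.
have -> : qratio q c 4 (a * d + b) =
    qratio q c 4 (a * d) * qratio q (c + 4 * (a * d)) (4 + 4 * (a * d)) b.
  by rewrite /qratio !qpochD -!exprM -!exprD mulf_div.
apply: spec_mul => //.
have per4 e : z ^+ (e + 4 * (a * d)) = z ^+ e.
  by rewrite exprD [z ^+ (4 * _)]exprM expr_mul_order.
have -> : qratio z c 4 b = qratio z (c + 4 * (a * d)) (4 + 4 * (a * d)) b.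
  by rewrite /qratio !per4.
apply: spec_qpoch_ratio; try exact: spec_exp.
by rewrite per4 qpoch4_neq0.
Qed.

(** The factor [n] vanishes at z, but (q^4;q^4)_m may vanish too, so [spec_qratio] is needed to show
    that the Pochhammer ratio is regular. *)
Lemma spec_rhs_root n m l e : (d %| n)%N ->
  specializes (closed_form q n m l e) 0.
Proof.
move=> dn; have d0 : (0 < d)%N by rewrite /d addn1.
have qn0 : specializes (qnum q n) 0.
  have <- : qnum z n = 0.
    by rewrite /qnum -(divnK dn) mulnC exprM zd expr1n subrr mul0r.
  exact: spec_qnum.
have [beta betaP] := spec_qratio 2.
rewrite /closed_form -expr_div_n -exprMn.
rewrite -[qpoch _ _ _ / _]/(qratio q 2 4 m) (divn_eq m d).
have <- : (0 * (beta (m %/ d)%N * qratio z 2 4 (m %% d)%N)) ^+ l.+1 * z ^- e = 0.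
  by rewrite !mul0r expr0n mul0r.
apply: spec_mul.
  by apply/spec_exp/spec_mul/betaP; rewrite ?ltn_mod.
apply: spec_inv; last exact: spec_exp.
rewrite expf_neq0 //; apply: contraTneq isT => z0.
by have /eqP := zd; rewrite z0 expr0n (gtn_eqF d0) eq_sym oner_eq0.
Qed.

Variables (x : {fraction R}) (y : L).
Hypotheses (xy : specializes x y) (y0 : y != 0).
Hypothesis yz : forall i, y * z ^+ i != 1 /\ y != z ^+ i.

Lemma qpoch_y_neq0 k : qpoch (y * z ^+ 4) (z ^+ 4) k != 0.
Proof.
apply: qpoch_neq0 => j _; rewrite -mulrA -exprM -exprD.
by case: (yz (4 + 4 * j)).
Qed.

Lemma qpoch_Vy_neq0 k : qpoch (z ^+ 4 / y) (z ^+ 4) k != 0.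
Proof.
apply: qpoch_neq0 => j _; rewrite mulrAC -exprM -exprD.
case: (yz (4 + 4 * j)) => _; apply: contraNneq => e.
by rewrite -[y]mul1r -e mulfVK.
Qed.

(** The ratio free of x contributes the square of [beta a]. The ratios in x are regular because y is
    not a power of z, and they split over blocks because z has period d. *)
Lemma spec_alpha_root : {gamma : nat -> L | forall a b, (b < d)%N ->
  specializes (alpha q x (a * d + b)) (gamma a * alpha z y b)}.
Proof.
have [beta betaP] := spec_qratio 1.
pose xi k := (qpoch (y * z) (z ^+ 4) k / qpoch (y * z ^+ 4) (z ^+ 4) k)
    * (qpoch (z / y) (z ^+ 4) k / qpoch (z ^+ 4 / y) (z ^+ 4) k).
exists (fun a => beta a ^+ 2 * xi (a * d)%N) => a b bd.
have xiD : xi (a * d + b)%N = xi (a * d)%N * xi b.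
  by rewrite /xi !qpochD !expr_mul_order -!mulf_div mulrACA.
rewrite !alpha_split -[_ / qpoch (q ^+ 4) (q ^+ 4) _]/(qratio q 1 4 _).
rewrite -[_ / qpoch (z ^+ 4) (z ^+ 4) _]/(qratio z 1 4 _) -!(mulrA (_ ^+ 2)) -/(xi b).
set u := z ^+ (2 * b) * _.
have -> : beta a ^+ 2 * (xi (a * d)%N * (u * (qratio z 1 4 b ^+ 2 * xi b))) =
    u * ((beta a * qratio z 1 4 b) ^+ 2 * xi (a * d + b)%N).
  rewrite xiD; ring.
have per i : z ^+ (i * (a * d + b)) = z ^+ (i * b).
  by rewrite mulnDr exprD mulnA mulnC exprM zd expr1n mul1r.
apply: spec_mul.
  rewrite /u -per; apply: spec_mul; first exact: spec_exp.
  have -> : qnum z (8 * b + 1) = qnum z (8 * (a * d + b) + 1).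
    by rewrite /qnum (exprD z (8 * b)) (exprD z (8 * (a * d + b))) per.
  exact: spec_qnum.
apply: spec_mul; first by apply: spec_exp; apply: betaP.
have q4 := spec_exp 4 qz.
apply: spec_mul.
- by apply: spec_qpoch_ratio (qpoch_y_neq0 _); apply: spec_mul.
- by apply: spec_qpoch_ratio (qpoch_Vy_neq0 _); apply: spec_div.
Qed.

Lemma spec_sum_convpow_root N l : (l <= 3)%N ->
  specializes (\sum_(0 <= k < N * d) convpow l (alpha q x) k) 0.
Proof.
move=> l3; have d0 : (0 < d)%N by rewrite /d addn1.
have [gamma gammaP] := spec_alpha_root.
pose v k := gamma (k %/ d)%N * alpha z y (k %% d)%N.
(* The truncations lose nothing: only k < N d matters, and [alpha z y b] is 0 for r < b < d. *)
pose C := \poly_(a < N) gamma a; pose W := \poly_(b < r.+1) alpha z y b.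
have sW : (size W <= r.+1)%N by apply: size_poly.
have vE k : (k < N * d)%N -> v k = C`_(k %/ d) * W`_(k %% d).
  move=> kN; rewrite !coef_poly ltn_divLR // kN; congr (_ * _).
  by case: ltnP => // rk; apply: (@alpha_eq0 _ z y r zd).
have W1 : W.[1] = 0.
  rewrite horner_poly -(big_mkord xpredT (fun k => alpha z y k * 1 ^+ k)).
  under eq_bigr => k _ do rewrite expr1n mulr1.
  apply: (@sum_alpha_root _ z y r zd y0 _ (L_char0 1)) => k kr.
  apply: mulf_neq0 (qpoch_Vy_neq0 _); apply: mulf_neq0 (qpoch_y_neq0 _).
  by rewrite expf_neq0 // qpoch4_neq0 // /d; lia.
have <- : \sum_(0 <= k < N * d) convpow l v k = 0.
  rewrite (sum_convpow d0 _ _ vE) ?W1 ?expr0n ?mulr0 //.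
    apply: leq_trans (size_poly_exp_leq _ _) _; rewrite /d.
    have : ((size W).-1 * l.+1 <= r * 4)%N by apply: leq_mul; lia.
    lia.
  by apply: leq_trans sW _; rewrite /d; lia.
apply: spec_sum_nat => k /= kN; apply: spec_convpow kN => j _.
by rewrite {1}(divn_eq j d); apply: gammaP; rewrite ltn_mod.
Qed.

End RootOfUnity.

(** * Specializing x to q^n or q^-n *)

Section NotRootOfUnity.
Variables (n m l e : nat).
Hypotheses (nm : (n = 4 * m + 1)%N) (l3 : (l <= 3)%N) (em : (e = l.+1 * m)%N).
Hypotheses (z0 : z != 0) (z_gt0 : forall i, (0 < i)%N -> z ^+ i != 1).

Lemma spec_rhs : specializes (closed_form q n m l e) (closed_form z n m l e).
Proof.
have q4 := spec_exp 4 qz; apply: spec_mul.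
  apply: spec_mul; first by apply/spec_exp/spec_qnum.
  apply: spec_div; try (apply/spec_exp/spec_qpoch => //; exact: spec_exp).
  rewrite expf_neq0 //; apply: qpoch_neq0 => j _.
  by rewrite -exprM -exprD z_gt0.
by apply: spec_inv; [rewrite expf_neq0 | apply: spec_exp].
Qed.

Variables (x : {fraction R}) (y : L).
Hypotheses (xy : specializes x y) (y0 : y != 0).
Hypothesis yn : y = z ^+ n \/ y = z ^- n.

Lemma spec_alpha k :
  qpoch (z ^+ 4) (z ^+ 4) k != 0 -> qpoch (y * z ^+ 4) (z ^+ 4) k != 0 ->
  qpoch (z ^+ 4 / y) (z ^+ 4) k != 0 ->
  specializes (alpha q x k) (alpha z y k).
Proof.
move=> d1 d2 d3; rewrite !alpha_split; have q4 := spec_exp 4 qz.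
apply: spec_mul; first by apply: spec_mul; [exact: spec_exp|exact: spec_qnum].
apply: spec_mul; first apply: spec_mul; first apply: spec_exp.
- exact: spec_qpoch_ratio.
- by apply: spec_qpoch_ratio => //; apply: spec_mul.
- by apply: spec_qpoch_ratio => //; apply: spec_div.
Qed.

Lemma spec_sum_convpow :
  specializes (\sum_(0 <= k < n) convpow l (alpha q x) k) (closed_form z n m l e).
Proof.
have aE k : alpha z y k = alpha z (z ^+ n) k by case: yn => ->; rewrite ?alpha_inv.
have n0 : (0 < n)%N by lia.
pose W := \poly_(k < m.+1) alpha z y k.
have sW : (size W <= m.+1)%N by apply: size_poly.
have vE k : (k < 1 * n)%N ->
    alpha z y k = (1 : {poly L})`_(k %/ n) * W`_(k %% n).
  rewrite mul1n => kn; rewrite divn_small // modn_small // coef1 mul1r coef_poly.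
  (* The factor 1 - (z / z^n) z^(4m) is 0, as n = 4m+1. *)
  case: ltnP => // mk; rewrite aE /alpha (@qpoch_eq0 _ (z / _) _ _ m) //.
    by rewrite !(mulr0, mul0r).
  rewrite mulrAC -exprM -exprS -addn1 nm divff ?expf_neq0 //.
have <- : \sum_(0 <= k < 1 * n) convpow l (alpha z y) k = closed_form z n m l e.
  rewrite (sum_convpow n0 _ _ vE).
  - rewrite big_nat1 expr1n coef1 mul1r.
    rewrite horner_poly -(big_mkord xpredT (fun k => alpha z y k * 1 ^+ k)).
    under eq_bigr => k _ do rewrite expr1n mulr1 aE nm.
    rewrite sum_alpha_terminating // -nm /closed_form em -expr_div_n -exprMn.
    by rewrite (mulnC l.+1) (exprM z m) -(exprVn (z ^+ m)) -exprMn.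
  - apply: leq_trans (size_poly_exp_leq _ _) _; rewrite nm.
    have : ((size W).-1 * l.+1 <= m * 4)%N by apply: leq_mul; lia.
    lia.
  - by apply: leq_trans sW _; lia.
rewrite mul1n; apply: spec_sum_nat => k /= kn; apply: spec_convpow kn => j jn.
(* The exponents differ modulo 4, so no denominator vanishes. *)
have yz i : z ^+ (4 + 4 * i) != z ^+ n.
  by apply/eqP => /(expr_not_root_inj z0 z_gt0); lia.
have yz' i : z ^+ n * z ^+ (4 + 4 * i) != 1 by rewrite -exprD z_gt0 // addn_gt0 n0.
have zn0 : z ^+ n != 0 by rewrite expf_neq0.
apply: spec_alpha; apply: qpoch_neq0 => i _.
- by rewrite -exprM -exprD z_gt0.
- rewrite -mulrA -exprM -exprD; case: yn => -> //.
  by rewrite mulrC -(inj_eq (mulIf zn0)) mulfVK // mul1r.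
- rewrite mulrAC -exprM -exprD; case: yn => ->; rewrite ?invrK 1?mulrC //.
  by rewrite mulrC -(inj_eq (mulIf zn0)) mulfVK // mul1r.
Qed.

End NotRootOfUnity.
End QSpecialization.
End Specialization.

(** * Lowest terms over Q[q][x] *)

Section LowestTerms.
Implicit Types a b c d : Rqx.

(** Degree in x plus the q-degree of the leading coefficient: additive on products, and 0 only for
    units among nonzero polynomials. *)
Definition bideg a := ((size a).-1 + (size (lead_coef a)).-1)%N.

Lemma bideg_mul a b : a != 0 -> b != 0 -> bideg (a * b) = (bideg a + bideg b)%N.
Proof.
move=> a0 b0; rewrite /bideg lead_coefM !size_mul ?lead_coef_eq0 //.
move: (a0) (b0); rewrite -lead_coef_eq0 -(lead_coef_eq0 b) -!size_poly_gt0.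
rewrite -(size_poly_gt0 a) -(size_poly_gt0 b) in a0 b0.
move=> la lb; move: (size a) (size b) (size (lead_coef a)) (size (lead_coef b))
  a0 b0 la lb.
clear; lia.
Qed.

Lemma bideg0_unit a : a != 0 -> bideg a = 0%N -> a \is a GRing.unit.
Proof.
move=> a0 /eqP; rewrite addn_eq0 => /andP[sa sl].
have /size_poly1P[p p0 aE] : size a == 1%N.
  by move: a0; rewrite -size_poly_gt0; lia.
move: sl; rewrite aE lead_coefC => sp.
have /size_poly1P[u u0 ->] : size p == 1%N.
  by move: p0; rewrite -size_poly_gt0; lia.
by do 2 apply: (rmorph_unit polyC); rewrite unitfE.
Qed.

(** Dividing out a common nonunit lowers [bideg b], so the process stops. *)
Lemma lowest_terms a b : b != 0 ->
  exists c d, [/\ d != 0, a * d = c * b & coprimer c d].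
Proof.
elim: {b}(bideg b).+1 {-2}b (ltnSn (bideg b)) a => // k IHk b bk a b0.
have [ab|/not_all_ex_not[e eP]] := classic (coprimer a b).
  by exists a, b.
have [ea nb] := imply_to_and _ _ eP; have [eb eU] := imply_to_and _ _ nb.
have [a' aE] := ea; have [b' bE] := eb.
have e0 : e != 0 by apply: contraNneq b0 => e0; rewrite bE e0 mulr0.
have b'0 : b' != 0 by apply: contraNneq b0 => e1; rewrite bE e1 mul0r.
have b'k : (bideg b' < k)%N.
  have : bideg e != 0%N by apply: contra_notN eU => /eqP; apply: bideg0_unit.
  by move: bk; rewrite bE bideg_mul //; move: (bideg _) (bideg _); clear; lia.
have [c [d [d0 adE cd]]] := IHk b' b'k a' b'0.
by exists c, d; split=> //; rewrite aE bE mulrAC adE mulrA.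
Qed.
End LowestTerms.

(** * Evaluation maps and divisibility by the modulus *)

Section Evaluations.

(** Sets x = y; values lie in Q(q) so that y = q^-n is allowed. *)
Definition eval_x (y : {fraction {poly rat}}) : Rqx -> {fraction {poly rat}} :=
  horner_eval y \o map_poly (@FracField.tofrac {poly rat}).
HB.instance Definition _ y := GRing.RMorphism.on (eval_x y).

(** Sets q = z and keeps x as an indeterminate. *)
Definition eval_q (z : algC) : Rqx -> {fraction {poly algC}} :=
  @FracField.tofrac {poly algC} \o map_poly (horner_eval z \o map_poly ratr).
HB.instance Definition _ z := GRing.RMorphism.on (eval_q z).

Local Notation Qx := {poly rat}.
Local Notation tofracq := (@FracField.tofrac {poly rat}).

Lemma eval_xE (y : {fraction {poly rat}}) (F : Rqx) :
  eval_x y F = (map_poly tofracq F).[y].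
Proof. by []. Qed.

Lemma eval_x_const y (c : Qx) : eval_x y c%:P = tofracq c.
Proof. by rewrite eval_xE map_polyC hornerC. Qed.

Lemma eval_xX y : eval_x y 'X = y.
Proof. by rewrite eval_xE map_polyX hornerX. Qed.

Lemma eval_q_const z (c : Qx) :
  eval_q z c%:P = FracField.tofrac ((map_poly ratr c).[z]%:P : {poly algC}).
Proof. by rewrite /eval_q /= map_polyC. Qed.

Lemma eval_qX z : eval_q z 'X = FracField.tofrac ('X : {poly algC}).
Proof. by rewrite /eval_q /= map_polyX. Qed.

Lemma eval_x_root (c : Qx) (F : Rqx) :
  eval_x (tofracq c) F = 0 -> exists G, F = G * ('X - c%:P).
Proof.
rewrite eval_xE horner_map => /eqP; rewrite tofrac_eq0 => Fc.
exact/factor_theorem.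
Qed.

(** 1 - c x is not monic, so division by it first costs a power of c. The remainder b vanishes by
    evaluation, and the power of c is then cancelled. *)
Lemma eval_x_root_inv (c : Qx) (F : Rqx) : c != 0 ->
  eval_x (tofracq c)^-1 F = 0 -> exists G, F = G * (1 - 'X * c%:P).
Proof.
move=> c0 Fc; set D := 1 - _.
have D0 : eval_x (tofracq c)^-1 D = 0.
  rewrite rmorphB rmorphM rmorph1 /= eval_xX eval_x_const mulVf ?subrr //.
  by rewrite tofrac_eq0.
(* c is invertible modulo D, because c x = 1 - D. *)
have cancel k G : (exists H, c%:P ^+ k * G = H * D) -> exists H, G = H * D.
  elim: k => [|k IHk]; first by rewrite mul1r.
  case=> H HE; apply: IHk; exists (c%:P ^+ k * G + 'X * H).
  rewrite mulrDl -mulrA (mulrCA _ _ D) -mulrA -HE /D exprS; ring.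
have [G [b [k E]]] : exists G b k, c%:P ^+ k * F = G * D + b%:P.
  elim/poly_ind: F {Fc} => [|F a [G [b [k E]]]].
    by exists 0, 0, 0%N; rewrite mulr0 mul0r addr0.
  exists (G * ('X * c%:P) - b%:P), (b + c ^+ k.+1 * a), k.+1.
  have -> : c%:P ^+ k.+1 * (F * 'X + a%:P) =
      c%:P * 'X * (c%:P ^+ k * F) + c%:P ^+ k.+1 * a%:P by rewrite exprS; ring.
  rewrite E /D polyCD polyCM -polyC_exp; ring.
have b0 : b = 0.
  move/(congr1 (eval_x (tofracq c)^-1)): E.
  rewrite rmorphM /= Fc mulr0 rmorphD rmorphM /= D0 mulr0 add0r /= eval_x_const.
  by move/esym/eqP; rewrite tofrac_eq0 => /eqP.
by apply: (cancel k); exists G; rewrite E b0 addr0.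
Qed.

Definition qint n : Qx := \sum_(i < n) 'X^i.

(** After multiplication by X - 1 the divisor is X^n - 1, which has n distinct roots in [algC]. *)
Lemma qint_dvdp n (h : Qx) : (0 < n)%N ->
  (forall z : algC, z ^+ n = 1 -> z != 1 -> (map_poly ratr h).[z] = 0) ->
  qint n %| h.
Proof.
move=> n0 hz; have X1 : 'X - 1 != 0 :> Qx by rewrite -polyC1 polyXsubC_eq0.
rewrite -(dvdp_mul2l _ _ X1) -subrX1 -(dvdp_map (@ratr algC)).
have [w w_prim] := C_prim_root_exists n0.
rewrite rmorphB rmorph1 /= map_polyXn -(factor_Xn_sub_1 w_prim).
rewrite -(big_map (fun i => w ^+ i) xpredT (fun z => 'X - z%:P)).
apply: uniq_roots_dvdp.
  apply/allP => z /mapP[i _ ->]; rewrite rootE rmorphM rmorphB rmorph1 /=.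
  rewrite map_polyX !hornerE; have [->|w1] := eqVneq (w ^+ i) 1.
    by rewrite subrr mul0r.
  by rewrite hz ?mulr0 // exprAC (prim_expr_order w_prim) expr1n.
rewrite uniq_rootsE map_inj_in_uniq ?iota_uniq // => i j.
rewrite !mem_index_iota => /andP[_ li] /andP[_ lj] /eqP.
by rewrite (eq_prim_root_expr w_prim) !modn_small // => /eqP.
Qed.

(** Each coefficient in x vanishes at these z, so the quotient is formed coefficientwise. *)
Lemma eval_q_root n (F : Rqx) : (0 < n)%N ->
  (forall z : algC, z ^+ n = 1 -> z != 1 -> eval_q z F = 0) ->
  exists G, F = G * (qint n)%:P.
Proof.
move=> n0 Fz; exists (map_poly (fun h => h %/ qint n) F).
apply/polyP => i; rewrite coefMC coef_map_id0 ?div0p // divpK //.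
apply: qint_dvdp => // z zn z1; have /eqP := Fz z zn z1.
rewrite /eval_q /= tofrac_eq0 => /eqP/(congr1 (fun p : {poly algC} => p`_i)).
by rewrite coef_map coef0.
Qed.

Definition modulus n : Rqx :=
  (qint n)%:P * (1 - 'X * ('X^n)%:P) * ('X - ('X^n)%:P).

(** The factors are split off in turn. Those already removed are nonzero at the next point: q^-n
    differs from q^n, and at q = z they become x - 1 and 1 - x. *)
Lemma modulus_divides n (F : Rqx) : (0 < n)%N ->
  eval_x (tofracq 'X^n) F = 0 -> eval_x (tofracq 'X^n)^-1 F = 0 ->
  (forall z : algC, z ^+ n = 1 -> z != 1 -> eval_q z F = 0) ->
  divides (modulus n) F.
Proof.
move=> n0 /eval_x_root[G ->] F1 Fz.
have Xn0 : ('X^n : Qx) != 0 by rewrite -size_poly_gt0 size_polyXn.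
have /(eval_x_root_inv Xn0)[H GE] : eval_x (tofracq 'X^n)^-1 G = 0.
  move/eqP: F1; rewrite rmorphM mulf_eq0 => /orP[/eqP //|].
  rewrite rmorphB /= eval_xX eval_x_const subr_eq0 => /eqP e; exfalso.
  have : tofracq ('X^n * 'X^n) == tofracq 1.
    by rewrite rmorphM rmorph1 /= -{1}e mulVf // tofrac_eq0.
  rewrite -subr_eq0 -rmorphB tofrac_eq0 subr_eq0 => /eqP/(congr1 (size \o polyseq)).
  rewrite /= -exprD size_polyXn size_poly1; move: n0; clear; lia.
have [|E HE] := @eval_q_root n H n0; last first.
  by exists E; rewrite GE HE /modulus !mulrA.
move=> z zn z1; have /eqP := Fz z zn z1; rewrite GE.
rewrite !rmorphM !rmorphB rmorphM rmorph1 /= eval_qX eval_q_const.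
rewrite map_polyXn hornerXn zn polyC1 rmorph1 mulr1.
rewrite -(rmorph1 (@FracField.tofrac {poly algC})) -!rmorphB /=.
rewrite -mulrA mulf_eq0 => /orP[/eqP // |].
rewrite -rmorphM /= tofrac_eq0 mulf_eq0 -opprB oppr_eq0 orbb.
by rewrite -polyC1 polyXsubC_eq0.
Qed.
End Evaluations.

(** * From specializations to the congruences *)

Section Congruence.
Local Notation tofrac := FracField.tofrac.

Lemma eqmodf_modulus n (A B : Kqx) : (0 < n)%N ->
  specializes (eval_x (tofrac 'X^n)) (A - B) 0 ->
  specializes (eval_x (tofrac 'X^n)^-1) (A - B) 0 ->
  (forall z : algC, z ^+ n = 1 -> z != 1 -> specializes (eval_q z) (A - B) 0) ->
  eqmodf A B (tofrac (modulus n)).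
Proof.
move=> n0 sp1 sp2 sp3; have [a [b [ABE b0' _]]] := sp1.
have b0 : b != 0 by rewrite -tofrac_eq0 (tofrac_neq0 b0').
have [c [d [d0 adE cd]]] := lowest_terms a b0.
have ABE' : A - B = tofrac c / tofrac d.
  rewrite ABE; apply/eqP; rewrite eqr_div ?tofrac_eq0 // -!rmorphM.
  by rewrite adE.
have Mc : divides (modulus n) c.
  apply: modulus_divides n0 (spec_eq0 sp1 ABE' d0) (spec_eq0 sp2 ABE' d0) _.
  by move=> z zn z1; apply: spec_eq0 (sp3 z zn z1) ABE' d0.
(* A divisor of the modulus divides [c], so coprimality with [d] is inherited. *)
exists (modulus n), c, d; split=> // e [u Me] ed; apply: cd ed.
by case: Mc => v ->; exists (v * u); rewrite Me mulrA.
Qed.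

Lemma qvar_not_root i : (0 < i)%N -> qvar ^+ i != 1.
Proof.
move=> i0; rewrite /qvar -rmorphXn -subr_eq0.
rewrite -(rmorph1 (@FracField.tofrac Rqx)) -rmorphB tofrac_eq0 -polyC_exp -polyCB.
by rewrite polyC_eq0 -size_poly_gt0 size_XnsubC.
Qed.

Lemma modulusE n :
  qnum qvar n * (1 - xvar * qvar ^+ n) * (xvar - qvar ^+ n) = tofrac (modulus n).
Proof.
have q1 : 1 - qvar != 0 by rewrite subr_eq0 eq_sym -[qvar]expr1 qvar_not_root.
rewrite /modulus !rmorphM !rmorphB rmorphM rmorph1 /= /xvar /qvar -rmorphXn /=.
rewrite -polyC_exp; do 2 congr (_ * _); apply: (mulfI q1).
rewrite mulrC mulfVK // -opprB subrX1 -mulNr opprB; congr (_ * _).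
by rewrite /qint !rmorph_sum; apply: eq_bigr => i _; rewrite !rmorphXn.
Qed.

(** Used for n and for the order of each n-th root of unity. *)
Lemma modn4_1 d : (0 < d)%N ->
  (forall p, prime p -> (p %| d)%N -> p = 1 %[mod 4]) -> d = 1 %[mod 4].
Proof.
elim: d {-2}d (leqnn d) => [|k IHk] d dk d0 H; first by lia.
have [d1|d1] := leqP d 1; first by have -> : d = 1%N by lia.
have pd := pdiv_dvd d; have pp := pdiv_prime d1.
rewrite -(divnK pd) -modnMmr (H _ pp pd) modnMmr muln1.
have lt : (d %/ pdiv d < d)%N by rewrite ltn_Pdiv // prime_gt1.
apply: IHk; first by lia.
  by rewrite divn_gt0 ?pdiv_gt0 // dvdn_leq.
by move=> p p_pr pdd; apply: H p_pr (dvdn_trans pdd (dvdn_div pd)).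
Qed.

Variable n : nat.
Hypothesis n_gt0 : (0 < n)%N.
Hypothesis n_primes : forall p, prime p -> (p %| n)%N -> p = 1 %[mod 4].
Let m := ((n - 1) %/ 4)%N.

Lemma n_eq : n = (4 * m + 1)%N.
Proof. have := modn4_1 n_gt0 n_primes; rewrite /m; lia. Qed.

Lemma convpow_congruence l : (l <= 3)%N ->
  eqmodf (\sum_(0 <= k < n) convpow l (alpha qvar xvar) k)
    (closed_form qvar n m l (l.+1 * m))
    (qnum qvar n * (1 - xvar * qvar ^+ n) * (xvar - qvar ^+ n)).
Proof.
move=> l3; rewrite modulusE.
have X_not_root i : (0 < i)%N -> tofrac 'X ^+ i != 1 :> {fraction {poly rat}}.
  move=> i0; rewrite -rmorphXn -subr_eq0.
  rewrite -(rmorph1 (@FracField.tofrac {poly rat})) -rmorphB tofrac_eq0.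
  by rewrite -size_poly_gt0 size_XnsubC.
have X0 : tofrac 'X != 0 :> {fraction {poly rat}} by rewrite tofrac_eq0 polyX_eq0.
have spec_x y : y = tofrac 'X ^+ n \/ y = tofrac 'X ^- n -> specializes (eval_x y)
  (\sum_(0 <= k < n) convpow l (alpha qvar xvar) k -
    closed_form qvar n m l (l.+1 * m)) 0.
  move=> yE; have sq : specializes (eval_x y) qvar (tofrac 'X).
    by have := spec_tofrac (eval_x y) ('X%:P); rewrite /= eval_x_const.
  have sx : specializes (eval_x y) xvar y.
    by have := spec_tofrac (eval_x y) 'X; rewrite /= eval_xX.
  have y0 : y != 0 by case: yE => ->; rewrite ?invr_eq0 expf_neq0.
  have z1 : 1 - tofrac 'X != 0 :> {fraction {poly rat}}.
    by rewrite subr_eq0 eq_sym -[tofrac 'X]expr1 X_not_root.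
  have s1 := spec_sum_convpow sq z1 n_eq l3 (erefl _) X0 X_not_root sx y0 yE.
  have s2 := spec_rhs sq z1 n m l (l.+1 * m) X0 X_not_root.
  by have := spec_sub s1 s2; rewrite subrr.
apply: eqmodf_modulus => //.
- by apply: spec_x; left; rewrite rmorphXn.
- by apply: spec_x; right; rewrite rmorphXn.
move=> z zn z1; have [d z_prim dn] := prim_order_exists n_gt0 zn.
have d1 : d = 1 %[mod 4].
  apply: modn4_1 => [|p p_pr pd]; first exact: prim_order_gt0 z_prim.
  exact: n_primes p_pr (dvdn_trans pd dn).
pose r := (d %/ 4)%N; have dE : d = (4 * r + 1)%N by rewrite /r; lia.
(* Embeds [algC] as the constants of the field of rational functions in x. *)
pose f := @FracField.tofrac {poly algC} \o polyC.
have z_prim' : (4 * r + 1).-primitive_root (f z).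
  by rewrite fmorph_primitive_root -dE.
have f1 a : (f a == 1) = (a == 1) by rewrite fmorph_eq1.
have sq : specializes (eval_q z) qvar (f z).
  have := spec_tofrac (eval_q z) ('X%:P).
  by rewrite /= eval_q_const map_polyX hornerX.
have sx : specializes (eval_q z) xvar (tofrac 'X).
  by have := spec_tofrac (eval_q z) 'X; rewrite /= eval_qX.
have y0 : tofrac 'X != 0 :> {fraction {poly algC}} by rewrite tofrac_eq0 polyX_eq0.
have fz1 : 1 - f z != 0 by rewrite subr_eq0 eq_sym f1.
have char0 i : i.+1%:R != 0 :> {fraction {poly algC}}.
  by rewrite -(rmorph_nat f) fmorph_eq0 Num.Theory.pnatr_eq0.
(* Powers of z are constants, whereas x is not. *)
have yz i : tofrac 'X * f z ^+ i != 1 /\ tofrac 'X != f z ^+ i.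
  have fE : f z ^+ i = tofrac ((z ^+ i)%:P) by rewrite -rmorphXn.
  rewrite fE -rmorphM -(rmorph1 (@FracField.tofrac {poly algC})) /=.
  split; rewrite -subr_eq0 -rmorphB tofrac_eq0 subr_eq0; apply/eqP => e.
    move/(congr1 (fun p : {poly algC} => p.[0])): e.
    by rewrite !hornerE => /esym/eqP; rewrite oner_eq0.
  move/(congr1 (fun p : {poly algC} => p`_1)): e.
  by rewrite coefX coefC => /eqP; rewrite oner_eq0.
have [N nE] : exists N, n = (N * (4 * r + 1))%N.
  by exists (n %/ d)%N; rewrite -dE divnK.
have s1 := spec_sum_convpow_root sq fz1 qvar_not_root z_prim' char0 sx y0 yz N l3.
rewrite -nE in s1.
have dn' : (4 * r + 1 %| n)%N by rewrite -dE.
have s2 := spec_rhs_root sq fz1 qvar_not_root z_prim' char0 m l (l.+1 * m) dn'.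
by have := spec_sub s1 s2; rewrite subr0.
Qed.
End Congruence.

(* MathComp world. The divisions by 2 and 4 are exact since n = 1 mod 4. *)
Theorem theorem3 (n : nat) (n_gt0 : (0 < n)%N)
    (n_primes : forall p : nat, prime p -> (p %| n)%N -> p = 1 %[mod 4]) :
  let q := qvar in
  let x := xvar in
  let m := ((n - 1) %/ 4)%N in
  let M := qnum q n * (1 - x * q ^+ n) * (x - q ^+ n) in
  [/\ eqmodf (\sum_(0 <= k < n) s_ q x k)
        (qnum q n ^+ 2
         * (qpoch (q ^+ 2) (q ^+ 4) m ^+ 2 / qpoch (q ^+ 4) (q ^+ 4) m ^+ 2)
         * q ^- ((n - 1) %/ 2)%N) M,
      eqmodf (\sum_(0 <= k < n) t_ q x k)
        (qnum q n ^+ 3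
         * (qpoch (q ^+ 2) (q ^+ 4) m ^+ 3 / qpoch (q ^+ 4) (q ^+ 4) m ^+ 3)
         * q ^- (3 * (n - 1) %/ 4)%N) M
    & eqmodf (\sum_(0 <= k < n) u_ q x k)
        (qnum q n ^+ 4
         * (qpoch (q ^+ 2) (q ^+ 4) m ^+ 4 / qpoch (q ^+ 4) (q ^+ 4) m ^+ 4)
         * q ^- (n - 1)%N) M].
Proof.
move=> q x m M; have nE := n_eq n_gt0 n_primes.
have C := convpow_congruence n_gt0 n_primes.
split.
- rewrite (_ : (n - 1) %/ 2 = 2 * m)%N; last by rewrite {1}nE -/m; lia.
  (* [s_] is [convpow 1] by conversion. *)
  exact: (C 1%N).
- rewrite (_ : 3 * (n - 1) %/ 4 = 3 * m)%N; last by rewrite {1}nE -/m; lia.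
  under eq_bigr => k _ do rewrite t_convpow.
  exact: (C 2%N).
- rewrite (_ : n - 1 = 4 * m)%N; last by rewrite {1}nE -/m; lia.
  under eq_bigr => k _ do rewrite u_convpow.
  exact: (C 3%N).
Qed.
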